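(* Let $d\ge2$ be an integer, let $\mathbb{F}$ be a field, and let $T:[n_1]\times\dots\times[n_d]\to\mathbb{F}$ be an order-$d$ tensor. Let $r_1^0,\dots,r_d^0$ be nonnegative integers and let $a^0_{j,i}:[n_j]\to\mathbb{F}$ be functions for every $j\in[d]$ and $i\in[r_j^0]$. Let $h>d$ be an integer, and assume: 1. for every $\theta\in[h]$ there exist nonnegative integers $r_1^\theta,\dots,r_d^\theta$, functions $a^\theta_{j,i}:[n_j]\to\mathbb{F}$ and functions $b^{0,\theta}_{j,i},b^\theta_{j,i}:\prod_{j'\ne j}[n_{j'}]\to\mathbb{F}$ such that \[T(x_1,\dots,x_d)=\sum_{j=1}^d\Big(\sum_{i=1}^{r_j^0}a^0_{j,i}(x_j)b^{0,\theta}_{j,i}(\overline{x_j})+\sum_{i=1}^{r_j^\theta}a^\theta_{j,i}(x_j)b^\theta_{j,i}(\overline{x_j})\Big);\] 2. for each $j\in[d]$ the functions $a^0_{j,1},\dots,a^0_{j,r_j^0},a^1_{j,1},\dots,a^1_{j,r_j^1},\dots,a^h_{j,1},\dots,a^h_{j,r_j^h}$ are linearly independent. Then there exist functions $b^0_{j,i}:\prod_{j'\ne j}[n_{j'}]\to\mathbb{F}$ such that $T(x_1,\dots,x_d)=\sum_{j=1}^d\sum_{i=1}^{r_j^0}a^0_{j,i}(x_j)b^0_{j,i}(\overline{x_j})$, and in particular the slice rank of $T$ is at most $r_1^0+\dots+r_d^0$.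
   Context: $[n]=\{1,\dots,n\}$. For $x=(x_1,\dots,x_d)$ and $j\in[d]$, $\overline{x_j}=(x_{j'})_{j'\neq j}$. The slice rank of $T$ is the smallest $k$ such that $T(x)=\sum_{j=1}^d\sum_{i=1}^{r_j}a_{j,i}(x_j)b_{j,i}(\overline{x_j})$ for some nonnegative integers $r_j$ with $\sum_j r_j=k$ and functions $a_{j,i}:[n_j]\to\mathbb{F}$, $b_{j,i}:\prod_{j'\ne j}[n_{j'}]\to\mathbb{F}$. *)

(* Defs.v *)
From HB Require Import structures.
From mathcomp Require Import all_boot all_order all_algebra.
From mathcomp Require Import boolp.
Set Implicit Arguments. Unset Strict Implicit. Unset Printing Implicit Defensive.
Import GRing.Theory.
Local Open Scope ring_scope.

(* Coordinates are indexed by 'I_d, and the j-th coordinate ranges over       *)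
(* 'I_(n j).  The dependent finite functions give extensional tuples.         *)
Definition coords (d : nat) (n : 'I_d -> nat) : Type :=
  {dffun forall j : 'I_d, 'I_(n j)}.

Definition coords_but (d : nat) (n : 'I_d -> nat) (j : 'I_d) : Type :=
  {dffun forall k : {k : 'I_d | k != j}, 'I_(n (val k))}.

Definition omit (d : nat) (n : 'I_d -> nat) (j : 'I_d) (x : coords n) :
  coords_but n j := [ffun k : {k : 'I_d | k != j} => x (val k)].

Definition tensor (F : fieldType) (d : nat) (n : 'I_d -> nat) : Type :=
  coords n -> F.

Definition slice_decomposable (F : fieldType) (d : nat) (n : 'I_d -> nat)
    (T : tensor F n) (k : nat) : Prop :=
  exists (r : 'I_d -> nat)
         (a : forall j : 'I_d, 'I_(r j) -> 'I_(n j) -> F)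
         (b : forall j : 'I_d, 'I_(r j) -> coords_but n j -> F),
    (\sum_(j < d) r j)%N = k /\
    forall x : coords n,
      T x = \sum_(j < d) \sum_(i < r j) a j i (x j) * b j i (omit j x).

(* The default value 0 is only reachable for d = 0, see slice_rankP.          *)
Definition slice_rank (F : fieldType) (d : nat) (n : 'I_d -> nat)
    (T : tensor F n) : nat :=
  match pselect (exists k : nat, `[< slice_decomposable T k >]) with
  | left ex_k => ex_minn ex_k
  | right _ => 0%N
  end.

Definition put (d : nat) (n : 'I_d -> nat) (j : 'I_d) (i : 'I_(n j))
    (y : coords_but n j) : coords n :=
  [ffun k : 'I_d => match eq_comparable k j with
    | left e => ecast z 'I_(n z) (esym e) i
    | right ne => y (Sub k (introN eqP ne))
    end].

Lemma put_omit (d : nat) (n : 'I_d -> nat) (j : 'I_d) (x : coords n) :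
  put (x j) (omit j x) = x.
Proof.
apply/ffunP => k; rewrite ffunE; case: eq_comparable => [e|ne].
  by case: _ / (esym e).
by rewrite ffunE.
Qed.

Lemma slice_decomposable_exists (F : fieldType) (d : nat) (n : 'I_d -> nat)
    (T : tensor F n) : (0 < d)%N -> exists k : nat, slice_decomposable T k.
Proof.
case: d n T => // d n T _; exists (\sum_(j < d.+1) n j)%N; exists n.
exists (fun j i z => (i == z)%:R).
exists (fun j i y => if j == ord0 then T (put i y) else 0).
split=> // x; rewrite big_ord_recl /= [X in _ + X]big1 ?addr0; last first.
  by move=> j _; rewrite big1 // => i _; rewrite mulr0.
rewrite (bigD1 (x ord0)) //= eqxx mul1r put_omit big1 ?addr0 // => i /negbTE ->.
by rewrite mul0r.
Qed.

Lemma slice_rankP (F : fieldType) (d : nat) (n : 'I_d -> nat)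
    (T : tensor F n) : (0 < d)%N ->
  slice_decomposable T (slice_rank T) /\
  forall k : nat, slice_decomposable T k -> (slice_rank T <= k)%N.
Proof.
move=> d_gt0; rewrite /slice_rank; case: pselect => [ex_k | []].
  case: ex_minnP => m /asboolP dec_m min_m; split=> // k dec_k.
  exact/min_m/asboolP.
by have [k dec_k] := slice_decomposable_exists T d_gt0; exists k; apply/asboolP.
Qed.

(* Main.v *)
Require Import Defs.
From HB Require Import structures.
From mathcomp Require Import all_boot all_order all_algebra.
Set Implicit Arguments. Unset Strict Implicit. Unset Printing Implicit Defensive.
Import GRing.Theory.
Local Open Scope ring_scope.

(** For each coordinate [j], extend the given independent functions to a basis
    of the functions on ['I_(n j)], and expand [T] in the tensor products of
    these bases.  By the decomposition number [t], a product of basis vectors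
    can only have a nonzero coefficient if, for some [j], its [j]-th factor is
    one of the [a0 j i] or one of the [a t j i].  If no factor is an [a0 j i],
    then each of the [h] values of [t] selects a coordinate [j]; as [h > d], two
    distinct values select the same one, whose factor then belongs to two
    disjoint families.  So every basis product occurring in [T] has some
    [a0 j i] as a factor, and collecting terms gives the decomposition. *)

(** A common element of the blocks of two different indices would occur twice in the
    concatenation. *)
Lemma uniq_flatten_map_inj (I T : eqType) (s : I -> seq T) (r : seq I) :
  uniq (flatten (map s r)) -> forall t t' x,
  t \in r -> t' \in r -> x \in s t -> x \in s t' -> t = t'.
Proof.
elim: r => //= u r IHr; rewrite cat_uniq => /and3P[_ /hasPn disj uniq_r] t t' x.
have no_x t1 : t1 \in r -> x \in s t1 -> x \notin s u.
  by move=> t1r xt1; apply: disj; apply/flatten_mapP; exists t1.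
rewrite !inE => /predU1P[->|tr] /predU1P[->|t'r] xt xt' //.
- by rewrite (negbTE (no_x _ t'r xt')) in xt.
- by rewrite (negbTE (no_x _ tr xt)) in xt'.
exact: IHr uniq_r _ _ _ tr t'r xt xt'.
Qed.

Lemma free_extend (K : fieldType) (vT : vectType K) (X : seq vT) :
  free X -> exists Y, basis_of fullv (X ++ Y).
Proof.
move=> freeX; exists (vbasis (<<X>>^C)%VS); rewrite -(addv_complf <<X>>).
apply: cat_basis; first by rewrite directv_addE /= !directv_trivial capv_compl eqxx.
  by rewrite basisEfree freeX subvv leq_eqVlt (eqP freeX) eqxx.
exact: vbasisP.
Qed.

(** [XD.1] is a basis of the functions extending [S], and [XD.2 x k] is the [k]-th coordinate of the
    indicator of [x]. The sum in the second clause is then the [k]-th coordinate of [v], itself a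
    basis vector. *)
Lemma free_extend_dual (F : fieldType) (n : nat)
    (S : seq {ffun 'I_n -> F^o}) : free S ->
  exists XD : ('I_n -> {ffun 'I_n -> F^o}) * ('I_n -> 'I_n -> F),
    (forall x y, \sum_k XD.2 x k * (XD.1 k y : F) = (x == y)%:R) /\
    (forall v k, v \in S -> XD.1 k != v -> \sum_x (v x : F) * XD.2 x k = 0).
Proof.
move=> /free_extend[Y basisX].
have sizeX : size (S ++ Y) == n.
  by rewrite -(size_basis (X := in_tuple _) basisX) dimvf /dim /= muln1 card_ord.
pose X := Tuple sizeX; rewrite -[S ++ Y]/(tval X) in basisX.
pose delta x : {ffun 'I_n -> F^o} := [ffun z => (x == z)%:R].
exists (fun k : 'I_n => X`_k, fun x k => coord X k (delta x)); split=> [x y|v k vS Xkv] /=.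
  have := coord_basis basisX (memvf (delta x)) => /ffunP/(_ y).
  rewrite ffunE => ->; rewrite sum_ffunE.
  by apply: eq_bigr => k _; rewrite ffunE.
have -> : \sum_x v x * coord X k (delta x) = coord X k v.
  have {2}-> : v = \sum_x (v x : F) *: delta x.
    apply/ffunP => z; rewrite sum_ffunE (bigD1 z) //= !ffunE eqxx.
    rewrite [X in _ + X]big1 ?addr0; first by rewrite /GRing.scale /= mulr1.
    by move=> x /negbTE xz; rewrite !ffunE xz scaler0.
  by rewrite linear_sum; apply: eq_bigr => x _; rewrite linearZ.
have vX : v \in X by rewrite mem_cat vS.
have iX : (index v X < n)%N by have := vX; rewrite -index_mem size_tuple.
rewrite -(nth_index 0 vX) -[index v X]/(val (Ordinal iX)).
rewrite coord_free ?(basis_free basisX) //; case: eqP => // ki.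
by rewrite -ki /= nth_index ?eqxx in Xkv.
Qed.

(** Through [fprod], dependent functions become functions into a tagged sum, where the non-dependent
    distributivity applies. *)
Lemma bigA_distr_dffun (R : Type) (zero one : R) (mul : Monoid.mul_law zero)
    (add : Monoid.add_law zero mul) (I : finType) (J : I -> finType)
    (P : forall i, J i -> R) :
  \big[mul/one]_(i : I) \big[add/zero]_(j : J i) P i j =
  \big[add/zero]_(x : {dffun forall i, J i}) \big[mul/one]_(i : I) P i (x i).
Proof.
pose Q i : {ffun J i -> R} := [ffun j => P i j].
transitivity (\big[add/zero]_(t : fprod J) \big[mul/one]_(i in I) Q i (t i)).
  rewrite big_fprod -(bigA_distr_big_dep (fun i => tagged_with J i)
    (fun i u => untag zero (Q i) u)).
  apply: eq_bigr => i _; rewrite -(big_tag (fun i j => Q i j)).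
  by under [RHS]eq_bigr do rewrite ffunE.
rewrite [RHS](reindex (@dffun_of_fprod I J)) /=; last exact/onW_bij/dffun_of_fprod_bij.
by apply: eq_bigr => t _; apply: eq_bigr => i _; rewrite !ffunE.
Qed.

Section Coordinates.
Variables (d : nat) (n : 'I_d -> nat).
Local Notation X := {dffun forall j : 'I_d, 'I_(n j)}.

Lemma omit_put (j : 'I_d) (i : 'I_(n j)) (y : coords_but n j) :
  omit j (put i y) = y.
Proof.
apply/ffunP => k; rewrite !ffunE; case: eq_comparable => [e|ne].
  by exfalso; move: (valP k); rewrite e eqxx.
by case: k ne => k kj ne; rewrite (bool_irrelevance (introN eqP ne) kj).
Qed.

Lemma put_at (j : 'I_d) (i : 'I_(n j)) (y : coords_but n j) : put i y j = i.
Proof.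
rewrite ffunE; case: eq_comparable => // e.
by rewrite (eq_irrelevance e erefl).
Qed.

Lemma prod_omit (R : comPzSemiRingType) (j : 'I_d)
    (G : forall k : 'I_d, 'I_(n k) -> R) (x : coords n) :
  \prod_k G k (x k) =
  G j (x j) * \prod_(k : {k | k != j}) G (val k) (omit j x k).
Proof.
rewrite (bigD1 j) //=; congr (_ * _).
rewrite (big_sub [pred k | k != j]) /=.
by apply: eq_bigr => k _; rewrite ffunE.
Qed.

Lemma sum_coords_split (R : nmodType) (j : 'I_d) (G : coords n -> R) :
  \sum_(x : X) G x =
  \sum_(y : {dffun forall k : {k | k != j}, 'I_(n (val k))})
    \sum_(i < n j) G (put i y).
Proof.
rewrite pair_big /= (reindex (fun p :
  {dffun forall k : {k | k != j}, 'I_(n (val k))} * 'I_(n j) =>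
  put p.2 p.1 : X)) //=.
exists (fun x => (omit j x, x j)) => [[y i] _ | x _] /=.
  by rewrite omit_put put_at.
exact: put_omit.
Qed.

(** With the coordinates other than [j] fixed, the sum over [x j] factors through the sum assumed to
    vanish. *)
Lemma sum_slice_eq0 (R : comPzRingType) (j : 'I_d) (u : 'I_(n j) -> R)
    (v : coords_but n j -> R) (G : forall k : 'I_d, 'I_(n k) -> R) :
  \sum_i u i * G j i = 0 ->
  \sum_(x : X) u (x j) * v (omit j x) * \prod_k G k (x k) = 0.
Proof.
move=> u0; rewrite (sum_coords_split j
  (fun x => u (x j) * v (omit j x) * \prod_k G k (x k))).
apply: big1 => y _.
under eq_bigr do rewrite (prod_omit j) put_at omit_put mulrACA.
by rewrite -mulr_suml u0 mul0r.
Qed.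

(** Multiplying the duality relations over all [j] and distributing gives the Kronecker delta on
    [coords n]. *)
Lemma tensor_expand (F : fieldType) (T : tensor F n)
    (B D : forall j : 'I_d, 'I_(n j) -> 'I_(n j) -> F) :
  (forall j x y, \sum_k D j x k * B j k y = (x == y)%:R) ->
  forall x : coords n,
  T x = \sum_(e : X) (\sum_(z : X) T z * \prod_j D j (z j) (e j))
                     * \prod_j B j (e j) (x j).
Proof.
move=> BD x; under eq_bigr do rewrite mulr_suml; rewrite exchange_big /=.
have expand (z : X) :
    \sum_(e : X) T z * \prod_j D j (z j) (e j) * \prod_j B j (e j) (x j)
    = T z * (z == x)%:R.
  under eq_bigr do rewrite -mulrA -big_split /=.
  rewrite -mulr_sumr -(bigA_distr_dffun _ _ (fun j k => D j (z j) k * B j k (x j))).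
  congr (_ * _); under eq_bigr do rewrite BD.
  case: eqP => [->|zx]; first by rewrite big1 // => j _; rewrite eqxx.
  have [j zxj] : exists j, z j != x j.
    apply/existsP; rewrite -negb_forall; apply: contra_notN zx => /forallP zx.
    by apply/ffunP => j; apply/eqP.
  by rewrite (bigD1 j) //= (negbTE zxj) mul0r.
under eq_bigr do rewrite expand.
rewrite (bigD1 (x : X)) //= eqxx mulr1 big1 ?addr0 // => z /negbTE ->.
by rewrite mulr0.
Qed.

End Coordinates.

Theorem theorem3p3 (d : nat) (hd : (2 <= d)%N) (F : fieldType)
    (n : 'I_d -> nat) (T : tensor F n)
    (r0 : 'I_d -> nat)
    (a0 : forall j : 'I_d, 'I_(r0 j) -> {ffun 'I_(n j) -> F^o})
    (h : nat) (hh : (d < h)%N)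
    (r : 'I_h -> 'I_d -> nat)
    (a : forall (t : 'I_h) (j : 'I_d), 'I_(r t j) -> {ffun 'I_(n j) -> F^o})
    (b0 : forall (t : 'I_h) (j : 'I_d), 'I_(r0 j) -> coords_but n j -> F)
    (b : forall (t : 'I_h) (j : 'I_d), 'I_(r t j) -> coords_but n j -> F)
    (hT : forall (t : 'I_h) (x : coords n),
      T x = \sum_(j < d)
        (\sum_(i < r0 j) (a0 j i (x j) : F) * b0 t j i (omit j x)
         + \sum_(i < r t j) (a t j i (x j) : F) * b t j i (omit j x)))
    (hfree : forall j : 'I_d,
      free ([seq a0 j i | i : 'I_(r0 j)]
            ++ flatten [seq [seq a t j i | i : 'I_(r t j)] | t : 'I_h])) :
  (exists c : forall j : 'I_d, 'I_(r0 j) -> coords_but n j -> F,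
    forall x : coords n,
      T x = \sum_(j < d) \sum_(i < r0 j) (a0 j i (x j) : F) * c j i (omit j x))
  /\ (slice_rank T <= \sum_(j < d) r0 j)%N.
Proof.
have [XD /all_and2[XD_dual XD_coord]] :=
  fin_all_exists (fun j => free_extend_dual (hfree j)).
(* The coefficient of [T] along the product of the basis vectors selected by [e]. *)
pose coef (e : {dffun forall j, 'I_(n j)}) := \sum_(z : {dffun forall j, 'I_(n j)})
  T z * \prod_j (XD j).2 (z j) (e j).
have coef_supp (e : {dffun forall j, 'I_(n j)}) : coef e != 0 ->
    exists p : {j & 'I_(r0 j)}, (XD (tag p)).1 (e (tag p)) == a0 _ (tagged p).
  move=> coef_e; apply/existsP; apply: contraNT coef_e.
  rewrite negb_exists => /forallP no_a0.
  have [/forallP supp|] := boolP [forall t : 'I_h,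
      [exists j, (XD j).1 (e j) \in [seq a t j i | i : 'I_(r t j)]]].
    have [f f_supp] := fin_all_exists (fun t => existsP (supp t)).
    have /injectivePn[t [t' tt' ftt']] : ~~ injectiveb f.
      by apply/injectiveP => /leq_card; rewrite !card_ord leqNgt hh.
    (* The basis vector at coordinate [f t] lies in the blocks of both [t] and [t'], whereas a free
       family has no repetition. *)
    have := free_uniq (hfree (f t)); rewrite cat_uniq => /and3P[_ _].
    move=> /uniq_flatten_map_inj/(_ t t' ((XD (f t)).1 (e (f t)))).
    rewrite !mem_enum => /(_ isT isT (f_supp t)); rewrite {}ftt'.
    by move/(_ (f_supp t'))/eqP; rewrite (negbTE tt').
  (* Some [t] selects no coordinate: every slice of the [t]-th decomposition then contributes zero
     to [coef e]. *)
  rewrite negb_forall => /existsP[t]; rewrite negb_exists => /forallP no_at.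
  apply/eqP; rewrite /coef; under eq_bigr do rewrite (hT t) mulr_suml.
  rewrite exchange_big big1 //= => j _.
  under eq_bigr do rewrite mulrDl !mulr_suml.
  rewrite big_split /= exchange_big [X in _ + X]exchange_big /=.
  rewrite !big1 ?addr0 // => i _.
    refine (@sum_slice_eq0 _ _ F _ (a t j i) (b t j i)
      (fun k z => (XD k).2 z (e k)) _).
    apply: XD_coord.
      rewrite mem_cat; apply/orP; right; apply/flattenP.
      exists [seq a t j i | i : 'I_(r t j)]; last exact: image_f.
      exact: image_f.
    by apply: contraNneq (no_at j) => ->; apply: image_f.
  refine (@sum_slice_eq0 _ _ F _ (a0 j i) (b0 t j i)
    (fun k z => (XD k).2 z (e k)) _).
  apply: XD_coord; first by rewrite mem_cat image_f.
  exact: (no_a0 (Tagged (fun j => 'I_(r0 j)) i)).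
(* A product may have several factors among the [a0]; picking one ensures that each [e] is counted
   in a single [c j i]. *)
pose slot (e : {dffun forall j, 'I_(n j)}) := [pick p : {j & 'I_(r0 j)} |
  (XD (tag p)).1 (e (tag p)) == a0 _ (tagged p)].
pose c j (i : 'I_(r0 j)) (y : coords_but n j) :=
  \sum_(e | slot e == Some (Tagged (fun j => 'I_(r0 j)) i))
    coef e * \prod_(k : {k | k != j}) ((XD (val k)).1 (e (val k)) (y k) : F).
have Tc x : T x =
    \sum_(j < d) \sum_(i < r0 j) (a0 j i (x j) : F) * c j i (omit j x).
  rewrite (tensor_expand T XD_dual x).
  rewrite (sig_big_dep _ _ (fun j (i : 'I_(r0 j)) =>
    (a0 j i (x j) : F) * c j i (omit j x))) /=.
  under [RHS]eq_bigr do rewrite mulr_sumr.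
  (* For fixed [e], only the pair [slot e] contributes; if there is none, [coef_supp] makes the
     coefficient zero. *)
  rewrite (exchange_big_dep xpredT) //=; apply: eq_bigr => e _.
  rewrite -/(coef e) /slot; case: pickP => [p /eqP ep | no_p]; last first.
    rewrite [RHS]big_pred0 //; have [->|/coef_supp[p]] := eqVneq (coef e) 0.
      by rewrite mul0r.
    by rewrite no_p.
  rewrite [RHS](big_pred1 p) => [|q]; last first.
    by case: q => ? ?; rewrite eq_sym.
  rewrite (prod_omit (tag p) (fun k z => (XD k).1 (e k) z : F)) ep.
  exact: mulrCA.
split; first by exists c.
have [_ min_rank] := slice_rankP T (ltnW hd).
by apply: min_rank; exists r0, (fun j i z => a0 j i z), c.
Qed.
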